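(* Let $X$ and $Y$ be sets and $k$ a field. Let $u$ be a nonscalar element of $k\langle X\rangle * k[Y]$ (that is, $u\notin k$). Then the centralizer of $u$ in $k\langle X\rangle * k[Y]$ is commutative.
   Context: Here $k\langle X\rangle$ is the free associative (unital) $k$-algebra on $X$, $k[Y]$ is the commutative polynomial $k$-algebra on $Y$, and $k\langle X\rangle * k[Y]$ is their coproduct in the category of unital associative $k$-algebras. The sets $X$ and $Y$ may be infinite or empty. Equivalently, $k\langle X\rangle * k[Y]$ is the monoid algebra over $k$ of the monoid $\langle X\rangle * [Y]$, the coproduct of the free monoid $\langle X\rangle$ and the free abelian monoid $[Y]$; its elements are words in the disjoint union $X\sqcup Y$, two words being equal if and only if they differ only in the order of consecutive variables from $Y$. The centralizer of $u$ is the set of all elements of the algebra commuting with $u$. *)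

(* Defs.v *)
From HB Require Import structures.
From mathcomp Require Import all_boot all_order all_algebra.
From mathcomp Require Import generic_quotient finmap boolp.
From mathcomp.multinomials Require Export monalg.

Set Implicit Arguments.
Unset Strict Implicit.
Unset Printing Implicit Defensive.

Import GRing.Theory.
Local Open Scope ring_scope.
Local Open Scope quotient_scope.

(* Words in X + Y that differ only in the order of consecutive letters from Y:
   the congruence on the free monoid over X + Y generated by y y' ~ y' y. *)
Inductive yswap (X Y : Type) : seq (X + Y) -> seq (X + Y) -> Prop :=
| YSwapStep (s t : seq (X + Y)) (y y' : Y) :
    yswap (s ++ inr y :: inr y' :: t) (s ++ inr y' :: inr y :: t)
| YSwapRefl (w : seq (X + Y)) : yswap w w
| YSwapSym (w w' : seq (X + Y)) : yswap w w' -> yswap w' w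
| YSwapTrans (w w' w'' : seq (X + Y)) :
    yswap w w' -> yswap w' w'' -> yswap w w''.

Lemma yswap_cat (X Y : Type) (s s' t t' : seq (X + Y)) :
  yswap s s' -> yswap t t' -> yswap (s ++ t) (s' ++ t').
Proof.
move=> ss' tt'; apply: (@YSwapTrans _ _ _ (s' ++ t)).
  elim: ss' => [a b y y'|w|w w' _|w w' w'' _ h1 _ h2].
  - by rewrite -!catA /=; constructor.
  - exact: YSwapRefl.
  - exact: YSwapSym.
  - exact: YSwapTrans h1 h2.
elim: tt' => [a b y y'|w|w w' _|w w' w'' _ h1 _ h2].
- by rewrite !catA; constructor.
- exact: YSwapRefl.
- exact: YSwapSym.
- exact: YSwapTrans h1 h2.
Qed.

Lemma yswap_size (X Y : Type) (s t : seq (X + Y)) :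
  yswap s t -> size s = size t.
Proof.
by elim=> // [a b y y'|w w' w'' _ -> _ //]; rewrite !size_cat.
Qed.

Section XYMon.
Variables X Y : choiceType.

Definition yswapb : rel (seq (X + Y)) := fun s t => `[< yswap s t >].

Fact yswapb_refl : reflexive yswapb.
Proof. by move=> s; apply/asboolP/YSwapRefl. Qed.

Fact yswapb_sym : symmetric yswapb.
Proof. by move=> s t; apply/asboolP/asboolP => /YSwapSym. Qed.

Fact yswapb_trans : transitive yswapb.
Proof.
by move=> t s u /asboolP st /asboolP tu; apply/asboolP/(YSwapTrans st tu).
Qed.

Canonical yswap_equiv :=
  EquivRel yswapb yswapb_refl yswapb_sym yswapb_trans.

(* The coproduct of the free monoid on X and the free abelian monoid on Y. *)
Definition xymon := {eq_quot yswap_equiv}.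

HB.instance Definition _ := Choice.on xymon.
HB.instance Definition _ : EqQuotient _ yswap_equiv xymon :=
  EqQuotient.on xymon.

Definition xyword (w : seq (X + Y)) : xymon := \pi_xymon w.

Lemma xywordP (s t : seq (X + Y)) : xyword s = xyword t <-> yswap s t.
Proof.
by split=> [/eqmodP/asboolP|st]; last apply/eqmodP/asboolP.
Qed.

Lemma xyword_repr (m : xymon) : xyword (repr m) = m.
Proof. exact: reprK. Qed.

Definition xyone : xymon := xyword [::].
Definition xymul (m n : xymon) : xymon := xyword (repr m ++ repr n).

Lemma xymulE (s t : seq (X + Y)) :
  xymul (xyword s) (xyword t) = xyword (s ++ t).
Proof. by apply/xywordP/yswap_cat; apply/xywordP; rewrite xyword_repr. Qed.

Fact xymulA : associative xymul.
Proof.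
move=> m n p; rewrite -[m]xyword_repr -[n]xyword_repr -[p]xyword_repr.
by rewrite !xymulE catA.
Qed.

Fact xymul1m : left_id xyone xymul.
Proof. by move=> m; rewrite -[m]xyword_repr xymulE. Qed.

Fact xymulm1 : right_id xyone xymul.
Proof. by move=> m; rewrite -[m]xyword_repr xymulE cats0. Qed.

Fact xyunitm (m n : xymon) : xymul m n = xyone -> m = xyone /\ n = xyone.
Proof.
rewrite -[m]xyword_repr -[n]xyword_repr xymulE => /xywordP/yswap_size.
by case: (repr m) (repr n) => [|? ?] [|? ?].
Qed.

HB.instance Definition _ :=
  Choice_isMonomialDef.Build xymon xymulA xymul1m xymulm1 xyunitm.

End XYMon.

(* k<X> * k[Y] as the monoid algebra over k of xymon X Y;
   c%:MP is the image of the scalar c. *)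
Notation "{ 'xyalg' k [ X , Y ] }" := {malg k[xymon X Y]}
  (at level 0, k, X, Y at level 2, format "{ 'xyalg'  k [ X ,  Y ] }")
  : type_scope.

Section Universal.
Variables (k : fieldType) (X Y : choiceType).

Definition xvar (x : X) : {xyalg k[X, Y]} := << xyword [:: inl x] >>.
Definition yvar (y : Y) : {xyalg k[X, Y]} := << xyword [:: inr y] >>.

Lemma yvarC (y y' : Y) : yvar y * yvar y' = yvar y' * yvar y.
Proof.
rewrite /yvar !malgM_def !fgmulUU !mulr1; congr << _ >>.
by rewrite [LHS]xymulE [RHS]xymulE; apply/xywordP/(YSwapStep [::] [::]).
Qed.

Section Lift.
Variables (A : algType k) (f : X -> A) (g : Y -> A).
Hypothesis gC : forall y y', g y * g y' = g y' * g y.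

Definition xyletter (v : X + Y) : A :=
  match v with inl x => f x | inr y => g y end.

Definition xylift_mon (m : xymon X Y) : A := \prod_(v <- repr m) xyletter v.

Lemma xylift_monE (w : seq (X + Y)) :
  xylift_mon (xyword w) = \prod_(v <- w) xyletter v.
Proof.
have swapE s t : yswap s t ->
    \prod_(v <- s) xyletter v = \prod_(v <- t) xyletter v.
  elim=> [a b y y'|//|//|? ? ? _ -> _ //].
  by rewrite !big_cat !big_cons /=; congr (_ * _); rewrite !mulrA gC.
by apply/swapE/xywordP; rewrite xyword_repr.
Qed.

Lemma xylift_mon_mmorphism : mmorphism xylift_mon.
Proof.
split=> [m n|]; last by rewrite xylift_monE big_nil.
rewrite -[m]xyword_repr -[n]xyword_repr [mmul _ _]xymulE.
by rewrite !xylift_monE big_cat.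
Qed.

Definition xylift : {xyalg k[X, Y]} -> A := mmap (in_alg A) xylift_mon.

Lemma xylift_additive : additive xylift.
Proof. exact: mmap_is_additive. Qed.

Lemma xylift_scalable : scalable xylift.
Proof.
move=> c u; rewrite /xylift (mmapEw (msuppZ_le _ _)) mmapE scaler_sumr.
by apply: eq_bigr => m _; rewrite mcoeffZ /= !mulr_algl scalerA.
Qed.

Lemma xylift_multiplicative : multiplicative xylift.
Proof.
pose h : {mmorphism xymon X Y -> A} :=
  HB.pack xylift_mon (isMultiplicative.Build _ _ _ xylift_mon_mmorphism).
apply: (@commr_mmap_is_multiplicative _ _ _ (in_alg A) h) => u m m'.
by rewrite /GRing.comm /= mulr_algl mulr_algr.
Qed.

Lemma xylift_xvar x : xylift (xvar x) = f x.
Proof. by rewrite /xylift mmapU /= scale1r mul1r xylift_monE big_seq1. Qed.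

Lemma xylift_yvar y : xylift (yvar y) = g y.
Proof. by rewrite /xylift mmapU /= scale1r mul1r xylift_monE big_seq1. Qed.

Lemma xylift_uniq (h : {lrmorphism {xyalg k[X, Y]} -> A}) :
  (forall x, h (xvar x) = f x) -> (forall y, h (yvar y) = g y) -> h =1 xylift.
Proof.
move=> hx hy u; rewrite /xylift mmapE {1}[u]monalgE raddf_sum /=.
apply: eq_bigr => m _; rewrite -[X in << X *g _ >>]mulr1.
have -> : << u@_m * 1 *g m >> = u@_m *: << m >> :> {xyalg k[X, Y]}.
  by apply/malgP => n; rewrite mcoeffZ !mcoeffU -mulrnAr.
rewrite linearZ /= mulr_algl; congr (_ *: _).
rewrite -[m]xyword_repr xylift_monE; elim: (repr m) => [|v w IHw].
  by rewrite big_nil -(rmorph1 h).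
rewrite big_cons -IHw.
have -> : << xyword (v :: w) >> =
    << xyword [:: v] >> * << xyword w >> :> {xyalg k[X, Y]}.
  by rewrite malgM_def fgmulUU mulr1 [mmul _ _]xymulE.
by rewrite rmorphM; case: v => [x|y] /=; rewrite -?hx -?hy.
Qed.

End Lift.

(* Together with yvarC, this is the universal property of the coproduct of
   k<X> and k[Y] in the category of unital associative k-algebras. *)
Lemma xyalg_universal (A : algType k) (f : X -> A) (g : Y -> A) :
    (forall y y', g y * g y' = g y' * g y) ->
  exists2 h : {lrmorphism {xyalg k[X, Y]} -> A},
    (forall x, h (xvar x) = f x) /\ (forall y, h (yvar y) = g y) &
    forall h' : {lrmorphism {xyalg k[X, Y]} -> A},
      (forall x, h' (xvar x) = f x) -> (forall y, h' (yvar y) = g y) ->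
      h' =1 h.
Proof.
move=> gC.
pose h : {lrmorphism {xyalg k[X, Y]} -> A} := HB.pack (xylift f g)
  (GRing.isAdditive.Build _ _ _ (xylift_additive f g))
  (GRing.isScalable.Build _ _ _ _ _ (xylift_scalable f g))
  (GRing.isMultiplicative.Build _ _ _ (xylift_multiplicative f gC)).
exists h; last exact: xylift_uniq.
by split; [exact: xylift_xvar | exact: xylift_yvar].
Qed.

End Universal.

(* Main.v *)
(* The monoid of words is bi-ordered by comparing first the number of letters
   from X and then, lexicographically with respect to a well-order of the
   letters, the counting functions
   (i, l) |-> number of occurrences of l preceded by exactly i letters from X;
   hence leading monomials multiply and the algebra is a domain.  If the leading
   monomial m of u lies in [Y], then everything commuting with u has its leading
   monomial, hence its whole support, in [Y].  Otherwise an element commuting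
   with m is determined by its X-degree, because it is a prefix of a power of m.
   So the X-degree D on the centralizer of u has one-dimensional graded pieces.
   Choose p in the centralizer such that D p generates the values of D modulo
   D u.  Up to multiplication by powers of u, every v has the same degree as
   some power of p, so subtracting a multiple of that power lowers D v without
   changing a nonzero commutator [v, w], if w commutes with p.  But D [v, w] is
   at most D v + D w, so all such commutators vanish, first for w = p and then
   for every w. *)

Require Import Defs.
From mathcomp Require Import all_boot all_algebra.
From mathcomp.multinomials Require Import monalg.
From mathcomp Require Import finmap boolp wochoice zify.

Set Implicit Arguments.
Unset Strict Implicit.
Unset Printing Implicit Defensive.

Import GRing.Theory.
Local Open Scope ring_scope.

(** * Centralizers in a domain with a degree function *)

(** The last hypothesis expresses one-dimensional graded pieces, with a central [c] in place of a
    scalar. The drop in degree is asked only of nonzero differences because [D 0] is left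
    unspecified. *)
Lemma degree_centralizerC (R : nzRingType) (D : R -> nat) (u : R) :
    (forall v w : R, v != 0 -> w != 0 -> v * w != 0) ->
    (forall v w : R, v != 0 -> w != 0 -> D (v * w) = (D v + D w)%N) ->
    (forall v w : R, D (v - w)%R <= maxn (D v) (D w))%N ->
    u != 0 -> (0 < D u)%N ->
    (forall v w : R, GRing.comm v u -> GRing.comm w u -> v != 0 -> w != 0 ->
      D v = D w -> exists c : R, (forall x : R, GRing.comm c x) /\
        (v - c * w != 0 -> (D (v - c * w)%R < D v)%N)) ->
  forall v w : R, GRing.comm v u -> GRing.comm w u -> GRing.comm v w.
Proof.
move=> domR DM DB u0 Du line.
have expn0 (x : R) n : x != 0 -> x ^+ n != 0.
  by move=> x0; elim: n => [|n IHn]; rewrite ?oner_neq0 // exprS domR.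
have DX (x : R) n : x != 0 -> D (x ^+ n) = (n * D x)%N.
  move=> x0; elim: n => [|n IHn]; last by rewrite exprS DM ?IHn ?expn0.
  by have := DM 1 1 (oner_neq0 R) (oner_neq0 R); rewrite mulr1 expr0; lia.
(* The least such d generates the group of values of D modulo D u. *)
pose P (d : nat) := `[< (0 < d)%N /\ exists (p : R) (j : nat),
  [/\ p != 0, GRing.comm p u & D p = (d + j * D u)%N] >].
have exP : exists d, P d.
  by exists (D u); apply/asboolP; split=> //; exists u, 0%N; split=> //; lia.
case: (ex_minnP exP) => d /asboolP[d0 [p [j [p0 pu Dp]]]] dmin.
have degE (v : R) : v != 0 -> GRing.comm v u ->
    exists q, D (u ^+ (q * j) * v) = D (p ^+ q).
  move=> v0 vu; exists (D v %/ d)%N; rewrite DM ?expn0 // !DX // Dp.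
  have := divn_eq (D v) d; have := ltn_pmod (D v) d0.
  set q := (D v %/ d)%N; set r := (D v %% d)%N => rd Dv.
  have [r0|r0] := posnP r; first by rewrite Dv r0; nia.
  suff /dmin : P r by lia.
  (* This power of [p] subtracts [q * d] modulo [D u] without inverses: it contributes
     [q * d * (D u).-1], completing [q * d] to a multiple of [D u]. *)
  apply/asboolP; split=> //; exists (v * p ^+ (q * (D u).-1)).
  exists (q * d + q * (D u).-1 * j)%N; split; first by rewrite domR ?expn0.
    by apply/commr_sym/commrM; [exact/commr_sym | exact/commrX/commr_sym].
  rewrite DM ?expn0 // DX // Dp Dv; case: (D u) Du => // n _ /=; nia.
have commP (w : R) : GRing.comm w u -> GRing.comm w p ->
    forall v : R, GRing.comm v u -> GRing.comm v w.
  move=> wu wp v vu; apply/eqP; rewrite -subr_eq0; apply/negPn/negP => vw0.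
  have w0 : w != 0.
    by apply: contraNneq vw0 => ->; rewrite mulr0 mul0r subrr.
  have bnd (v1 : R) : v1 * w - w * v1 != 0 ->
      (D (v1 * w - w * v1)%R <= D v1 + D w)%N.
    have [->|v10] := eqVneq v1 0; first by rewrite mulr0 mul0r subrr eqxx.
    by move=> _; apply: leq_trans (DB _ _) _; rewrite !DM //; lia.
  (* Induction on the slack in [bnd]. Replacing [v] by [v1] multiplies the commutator by [u ^+ e],
     while [D v1] stays below [D (u ^+ e * v)], so the slack drops. *)
  have [N] := ubnP (D v + D w - D (v * w - w * v)%R)%N.
  elim: N => // N IHN in v vu vw0 *.
  have v0 : v != 0.
    by apply: contraNneq vw0 => ->; rewrite mulr0 mul0r subrr.
  have [q Dq] := degE v v0 vu; set e := (q * j)%N in Dq.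
  have uev : GRing.comm (u ^+ e * v) u.
    by apply/commr_sym/commrM; [exact/commrX | exact/commr_sym].
  have [|||||c [cC]] := line (u ^+ e * v) (p ^+ q) => //.
  - exact/commr_sym/commrX/commr_sym.
  - by rewrite domR ?expn0.
  - exact: expn0.
  set v1 := _ - _ => Dv1.
  have v1w : v1 * w - w * v1 = u ^+ e * (v * w - w * v).
    have wU : w * (u ^+ e * v) = u ^+ e * (w * v).
      by rewrite mulrA (commrX e wu) mulrA.
    have wP : w * (c * p ^+ q) = c * p ^+ q * w.
      by rewrite mulrA -(cC w) -mulrA (commrX q wp) mulrA.
    by rewrite /v1 mulrBl !mulrBr wU wP opprB addrA subrK -!mulrA.
  have v1w0 : v1 * w - w * v1 != 0 by rewrite v1w domR ?expn0.
  have v10 : v1 != 0.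
    by apply: contraNneq v1w0 => ->; rewrite mulr0 mul0r subrr.
  move=> ltN; apply: (IHN v1) => //.
    apply/commr_sym/commrB; first exact/commr_sym.
    by apply/commrM; [exact/commr_sym/cC | exact/commrX/commr_sym].
  have := bnd _ v1w0; have := bnd _ vw0; have := Dv1 v10.
  by rewrite v1w !DM ?expn0 //; lia.
move=> v w vu wu; apply: (commP w) => //.
exact: (commP p pu _ w wu).
Qed.

(** * Monoid algebras and leading monomials *)

Lemma malgC_comm (k : fieldType) (M : monomType) (c : k) (v : {malg k[M]}) :
  GRing.comm c%:MP v.
Proof.
apply/malgP => m; rewrite mcoeffCM.
have /= vC := msuppC_le (K := M) c.
rewrite (mcoeffMrw _ (fsubset_refl _) vC) big_seq_fset1.
rewrite [v in LHS]monalgE raddf_sum /= mulr_sumr; apply: eq_bigr => a _.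
by rewrite mcoeffC eqxx mulr1n mcoeffU mulm1 mulrnAr mulrC.
Qed.

Lemma malg_mulC (k : fieldType) (M : monomType) (v w : {malg k[M]}) :
    (forall a b, a \in msupp v -> b \in msupp w -> mmul a b = mmul b a) ->
  v * w = w * v.
Proof.
move=> vw; apply/malgP => m; rewrite mcoeffMl mcoeffMr.
apply: eq_big_seq => a av; apply: eq_big_seq => b bw.
by rewrite vw // mulrC.
Qed.

Section LeadingMonomial.
Context (k : fieldType) (M : monomType) (lt : M -> M -> Prop).
Context (lt_irr : forall a, ~ lt a a).
Context (lt_trans : forall a b c, lt a b -> lt b c -> lt a c).
Context (lt_total : forall a b, a <> b -> lt a b \/ lt b a).
Context (lt_mul2l : forall c a b, lt a b -> lt (mmul c a) (mmul c b)).
Context (lt_mul2r : forall c a b, lt a b -> lt (mmul a c) (mmul b c)).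

Definition lead (v : {malg k[M]}) (a : M) :=
  a \in msupp v /\ forall b, b \in msupp v -> b <> a -> lt b a.

Lemma lead_exists v : v != 0 -> exists a, lead v a.
Proof.
rewrite -msupp_eq0 => /fset0Pn[a0 a0v].
suff [a [av amax]] : exists a, a \in enum_fset (msupp v) /\
    forall b, b \in enum_fset (msupp v) -> b <> a -> lt b a by exists a.
have {a0v} : a0 \in enum_fset (msupp v) by [].
elim: (enum_fset _) a0 => // a s IHs a0 _.
case: s IHs => [_|b s /(_ b (mem_head _ _))[c [cs cmax]]].
  by exists a; split=> [|b]; rewrite inE // => /eqP.
have [ac|/eqP ac] := eqVneq a c.
  exists c; split=> [|d]; rewrite inE ?cs ?orbT // => /orP[/eqP->//|].
  exact: cmax.
have [ltac|ltca] := lt_total ac.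
  exists c; split=> [|d]; rewrite inE ?cs ?orbT // => /orP[/eqP->//|].
  exact: cmax.
exists a; split=> [|d]; rewrite inE ?eqxx // => /orP[/eqP->//|ds _].
have [->//|/eqP dc] := eqVneq d c; exact: (lt_trans (cmax _ ds dc) ltca).
Qed.

Lemma lead_neq0 v a : lead v a -> v != 0.
Proof. by case=> av _; apply: contraTneq av => ->; rewrite msupp0. Qed.

Lemma lead_uniq v a b : lead v a -> lead v b -> a = b.
Proof.
move=> [av amax] [bv bmax]; have [//|/eqP ab] := eqVneq a b.
have := lt_trans (bmax _ av ab) (amax _ bv (nesym ab)).
by move/lt_irr.
Qed.

Lemma lead_ltM v w a b c d : lead v a -> lead w b ->
  c \in msupp v -> d \in msupp w -> c <> a \/ d <> b ->
  lt (mmul c d) (mmul a b).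
Proof.
move=> [_ amax] [_ bmax] /amax ca /bmax db ab.
have [cEa|/eqP/ca{}ca] := eqVneq c a.
  by rewrite cEa; apply/lt_mul2l/db; case: ab.
have [->|/eqP/db{}db] := eqVneq d b; first exact: lt_mul2r.
exact: lt_trans (lt_mul2r _ ca) (lt_mul2l _ db).
Qed.

(** By strict monotonicity on both sides, no other pair of support monomials has product [mmul a b],
    so its coefficient is a product of two nonzero scalars. *)
Lemma lead_mul v w a b : lead v a -> lead w b -> lead (v * w) (mmul a b).
Proof.
move=> va wb; have [av _] := va; have [bw _] := wb; split; last first.
  move=> _ /msuppM_le[c [d [cv dw ->]]] cdab.
  apply: (lead_ltM va wb) => //.
  have [ca|/eqP] := eqVneq c a; last by left.
  by right=> db; case: cdab; rewrite ca db.
rewrite -mcoeff_neq0 mcoeffMl.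
rewrite (bigD1_seq a) ?fset_uniq //= (bigD1_seq b) ?fset_uniq //= eqxx mulr1n.
rewrite big1_seq ?addr0 => [|d /andP[db dw]]; last first.
  case: eqP => // E; have := lead_ltM va wb av dw (or_intror (elimN eqP db)).
  by rewrite E => /lt_irr.
rewrite big1_seq ?addr0 => [|c /andP[ca cv]]; last first.
  apply: big1_seq => d /andP[_ dw]; case: eqP => // E.
  have := lead_ltM va wb cv dw (or_introl (elimN eqP ca)).
  by rewrite E => /lt_irr.
by rewrite mulf_neq0 // mcoeff_neq0.
Qed.

Lemma malg_mul_neq0 (v w : {malg k[M]}) : v != 0 -> w != 0 -> v * w != 0.
Proof.
move=> /lead_exists[a va] /lead_exists[b wb].
exact: lead_neq0 (lead_mul va wb).
Qed.

Lemma lead_comm v w a b : lead v a -> lead w b -> GRing.comm v w ->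
  mmul a b = mmul b a.
Proof.
move=> va wb vw; apply: lead_uniq (lead_mul va wb) _.
by rewrite vw; apply: lead_mul.
Qed.

Lemma lead_cancel v w a b : lead v a -> lead w a ->
  lead (v - (v@_a / w@_a) *: w) b -> lt b a.
Proof.
move=> [av amax] [aw amax'] [bz _].
have ba : b <> a.
  move=> ba; move: bz; rewrite ba -mcoeff_neq0 mcoeffB mcoeffZ.
  by rewrite divfK ?mcoeff_neq0 // subrr eqxx.
have /fsubsetP/(_ _ bz) := msuppB_le v ((v@_a / w@_a) *: w).
rewrite in_fsetU => /orP[/amax|]; first exact.
by move/(fsubsetP (msuppZ_le _ _))/amax'; apply.
Qed.

Context (deg : M -> nat).
Context (degM : forall a b, deg (mmul a b) = (deg a + deg b)%N).
Context (lt_deg : forall a b, lt a b -> (deg a <= deg b)%N).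

Lemma lead_deg v a b : lead v a -> b \in msupp v -> (deg b <= deg a)%N.
Proof.
by move=> [_ amax] bv; have [->//|/eqP/(amax _ bv)/lt_deg] := eqVneq b a.
Qed.

Lemma malg_centralizerC (u : {malg k[M]}) (m : M) :
    lead u m -> (0 < deg m)%N ->
    (forall a b, mmul a m = mmul m a -> mmul b m = mmul m b ->
      deg a = deg b -> a = b) ->
  forall v w, GRing.comm v u -> GRing.comm w u -> GRing.comm v w.
Proof.
move=> um m0 deg_inj.
(* The maximum is defined for every [v], with value 0 at 0; [lt_deg] makes it the degree of the
   leading monomial when [v] is nonzero. *)
pose D (v : {malg k[M]}) := (\max_(a <- msupp v) deg a)%N.
have leD v a : a \in msupp v -> (deg a <= D v)%N.
  by move=> av; apply: leq_bigmax_seq.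
have leadD v a : lead v a -> D v = deg a.
  move=> va; apply/eqP; rewrite eqn_leq; apply/andP; split.
    by apply/bigmax_leqP_seq => b bv _; apply: lead_deg bv.
  by apply: leD; case: va.
apply: (@degree_centralizerC _ D u) => [||v w|||v w vu wu].
- exact: malg_mul_neq0.
- move=> v w /lead_exists[a va] /lead_exists[b wb].
  by rewrite (leadD _ _ va) (leadD _ _ wb) (leadD _ _ (lead_mul va wb)) degM.
- apply/bigmax_leqP_seq => a.
  move/(fsubsetP (msuppB_le _ _)); rewrite in_fsetU leq_max => /orP[] av _.
    by rewrite leD.
  by rewrite orbC leD.
- exact: lead_neq0 um.
- by rewrite (leadD _ _ um).
move=> /lead_exists[a va] /lead_exists[b wb].
have am := lead_comm va um vu.
have bm := lead_comm wb um wu.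
rewrite (leadD _ _ va) (leadD _ _ wb) => /(deg_inj _ _ am bm) ab {bm}.
rewrite -{b}ab in wb.
exists (v@_a / w@_a)%:MP; split=> [z|]; first exact: malgC_comm.
rewrite mul_malgC => /lead_exists[c zc]; rewrite (leadD _ _ zc).
have ca := lead_cancel va wb zc; rewrite ltn_neqAle lt_deg // andbT.
(* Cancellation alone gives only [deg c <= deg a]. The difference still commutes with [u], so [c]
   commutes with [m], and equal degrees would force [c = a]. *)
apply/eqP => cda; have zu : GRing.comm (v - (v@_a / w@_a) *: w) u.
  apply/commr_sym/commrB; first exact/commr_sym.
  rewrite -mul_malgC; apply/commrM; last exact/commr_sym.
  exact/commr_sym/malgC_comm.
have cm := lead_comm zc um zu.
by apply: (lt_irr (a := a)); rewrite -{1}(deg_inj c a).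
Qed.

End LeadingMonomial.

(** * Lexicographic orders and well-orders *)

Section LexOrder.
Context (I : Type) (prec : I -> I -> Prop).
Context (prec_trans : forall p q r, prec p q -> prec q r -> prec p r).
Context (prec_total : forall p q, p = q \/ prec p q \/ prec q p).
Context (prec_min : forall P : I -> Prop, (exists p, P p) ->
  exists p, P p /\ forall q, prec q p -> ~ P q).

Definition lexlt (f g : I -> nat) :=
  exists p, (f p < g p)%N /\ forall q, prec q p -> f q = g q.

Lemma lexlt_irr f : ~ lexlt f f.
Proof. by case=> p []; rewrite ltnn. Qed.

Lemma lexlt_trans f g h : lexlt f g -> lexlt g h -> lexlt f h.
Proof.
move=> [p [fgp fgE]] [q [ghq ghE]].
have [E|[pq|qp]] := prec_total p q.
- exists p; split=> [|r rp]; first by apply: ltn_trans fgp _; rewrite E.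
  by rewrite fgE // ghE // -E.
- exists p; split=> [|r rp]; first by rewrite -ghE.
  by rewrite fgE // ghE //; apply: prec_trans rp pq.
- exists q; split=> [|r rq]; first by rewrite fgE.
  by rewrite fgE ?ghE //; apply: prec_trans rq qp.
Qed.

(** The least index at which [f] and [g] differ, supplied by [prec_min], decides the comparison. *)
Lemma lexlt_total f g : f =1 g \/ lexlt f g \/ lexlt g f.
Proof.
have [[p fgp]|fg] := pselect (exists p, f p <> g p); last first.
  by left=> p; apply: contrapT => fgp; apply: fg; exists p.
right; have [] := @prec_min (fun p => f p <> g p); first by exists p.
move=> {fgp}p [/eqP fgp fgE].
have {}fgE q : prec q p -> f q = g q by move=> /fgE/contrapT.
move: fgp; rewrite neq_ltn => /orP[fg|gf]; [left|right]; exists p => //.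
by split=> // q /fgE.
Qed.

End LexOrder.

(** The strict order is the failure of [R y x] for a well-order [R]. Minima of two-element sets give
    totality and antisymmetry of [R]; minima of three-element sets give transitivity. *)
Lemma strict_well_order (T : eqType) : exists lt : T -> T -> Prop,
  [/\ forall x y z, lt x y -> lt y z -> lt x z,
      forall x y, x = y \/ lt x y \/ lt y x &
      forall P : T -> Prop, (exists x, P x) ->
        exists x, P x /\ forall y, lt y x -> ~ P y].
Proof.
have [R wo] := well_ordering_principle T.
have Rmin (P : T -> Prop) : (exists x, P x) ->
    exists x, P x /\ forall y, P y -> R x y.
  move=> [x Px]; have [|z [[zP zmin] _]] := wo [pred x | `[< P x >]].
    by exists x; rewrite inE; apply/asboolP.
  exists z; split=> [|y Py]; first by apply/asboolP; rewrite inE in zP.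
  by apply: zmin; rewrite inE; apply/asboolP.
have Rtot x y : R x y \/ R y x.
  have [|z [[->|->] zmin]] := Rmin (fun z => z = x \/ z = y).
  - by exists x; left.
  - by left; apply: zmin; right.
  - by right; apply: zmin; left.
have Ranti x y : R x y -> R y x -> x = y.
  move=> xy yx; have [|z [_ uz]] := wo (pred2 x y).
    by exists x; rewrite inE eqxx.
  rewrite -(uz x) ?(uz y) //; split; rewrite ?inE ?eqxx ?orbT // => t.
    by rewrite inE => /orP[/eqP->//|/eqP->]; case: (Rtot y y).
  by rewrite inE => /orP[/eqP->|/eqP->//]; case: (Rtot x x).
exists (fun x y => ~ R y x); split=> [x y z yx zy zx|x y|P /Rmin[x [Px xmin]]].
- have [|t [tP tmin]] := Rmin (fun t => [\/ t = x, t = y | t = z]).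
    by exists x; apply: Or31.
  case: tP => tE; rewrite tE in tmin.
  + have xy := tmin y (Or32 _ _ erefl); have xz := tmin z (Or33 _ _ erefl).
    by case: zy; rewrite -(Ranti _ _ xz zx).
  + by apply: yx; apply: tmin; apply: Or31.
  + by apply: zy; apply: tmin; apply: Or32.
- have [xy|xy] := boolP (R x y); have [yx|yx] := boolP (R y x).
  + by left; apply: Ranti.
  + by right; left; apply/negP.
  + by right; right; apply/negP.
  + by case: (Rtot x y) => R'; [case/negP: xy | case/negP: yx].
- by exists x; split=> // y xy /xmin.
Qed.

Section Grid.
Context (T : Type) (lt : T -> T -> Prop).
Context (lt_trans : forall x y z, lt x y -> lt y z -> lt x z).
Context (lt_total : forall x y, x = y \/ lt x y \/ lt y x).
Context (lt_min : forall P : T -> Prop, (exists x, P x) ->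
  exists x, P x /\ forall y, lt y x -> ~ P y).

Definition gridlt (p q : nat * T) : Prop :=
  (p.1 < q.1)%N \/ p.1 = q.1 /\ lt p.2 q.2.

Lemma gridlt_trans p q r : gridlt p q -> gridlt q r -> gridlt p r.
Proof.
move=> [pq|[E pq]] [qr|[E' qr]]; [left; lia|left; lia|left; lia|right].
by split; [rewrite E | apply: lt_trans qr].
Qed.

Lemma gridlt_total p q : p = q \/ gridlt p q \/ gridlt q p.
Proof.
case: p q => [i x] [j y]; have [ij|ji|<-] := ltngtP i j.
- by right; left; left.
- by right; right; left.
have [->|[xy|yx]] := lt_total x y; first by left.
- by right; left; right.
- by right; right; right.
Qed.

Lemma gridlt_min (P : nat * T -> Prop) : (exists p, P p) ->
  exists p, P p /\ forall q, gridlt q p -> ~ P q.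
Proof.
move=> [[i0 x0] P0].
have exi : exists i, `[< exists x, P (i, x) >].
  by exists i0; apply/asboolP; exists x0.
case: (ex_minnP exi) => i /asboolP/lt_min[x [Px xmin]] imin.
exists (i, x); split=> // -[j y] [/= ji|/= [-> yx]] Pjy; last exact: xmin Pjy.
have /imin : `[< exists x, P (j, x) >] by apply/asboolP; exists y.
by rewrite leqNgt ji.
Qed.

(** Serves left multiplication, which shifts the first index of the counts by the degree of the
    factor. *)
Lemma gridlt_add2l n i j x y :
  gridlt ((n + i)%N, x) ((n + j)%N, y) -> gridlt (i, x) (j, y).
Proof.
by case=> [/=|/= [ij xy]]; [left=> /=; lia | right; split=> //=; lia].
Qed.

End Grid.

(** * Counting invariants of words and the bi-order *)

Section WordInvariants.
Context (X Y : choiceType).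
Implicit Types (w s t : seq (X + Y)) (i : nat) (l : X + Y) (a b c : xymon X Y).

Definition isX l := if l is inl _ then true else false.

Definition word_deg w := count isX w.

(* The number of occurrences of l in w that are preceded by exactly i letters
   from X. *)
Fixpoint word_cnt w i l : nat :=
  match w with
  | [::] => 0
  | inl x :: t => if i is i'.+1 then word_cnt t i' l else inl x == l
  | inr y :: t => ((i == 0) && (inr y == l)) + word_cnt t i l
  end%N.

(** In [s ++ t] each letter of [t] gains [word_deg s] preceding letters from X; the guard is there
    because subtraction truncates. *)
Lemma word_cnt_cat s t i l : word_cnt (s ++ t) i l =
  (word_cnt s i l +
   if word_deg s <= i then word_cnt t (i - word_deg s) l else 0)%N.
Proof.
elim: s i => [|[x|y] s IHs] i /=; first by rewrite subn0.
  case: i => [|i]; first by rewrite addn0.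
  by rewrite IHs /word_deg /= add1n ltnS subSS.
by rewrite IHs /word_deg /= add0n addnA.
Qed.

Lemma word_cnt_gt w i l : (word_deg w < i)%N -> word_cnt w i l = 0%N.
Proof.
elim: w i => [|[x|y] w IHw] [|i] //=.
  by rewrite /word_deg /= add1n ltnS => /IHw.
by rewrite /word_deg /= add0n => /IHw ->.
Qed.

Lemma yswap_word_deg s t : yswap s t -> word_deg s = word_deg t.
Proof.
elim=> [a b y y'|//|? ? _ ->|? ? ? _ -> _ ->] //.
by rewrite /word_deg !count_cat.
Qed.

Lemma yswap_word_cnt s t : yswap s t -> word_cnt s =2 word_cnt t.
Proof.
elim=> [a b y y'|//|w w' _ h|w w' w'' _ h _ h'] i l.
- rewrite !word_cnt_cat /=; congr (_ + _)%N.
  by case: ifP => // _; rewrite addnCA.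
- by rewrite h.
- by rewrite h h'.
Qed.

Lemma word_cnt0_split w l : (0 < word_cnt w 0 l)%N ->
  exists s t, w = s ++ l :: t /\ word_deg s = 0%N.
Proof.
elim: w => [//|[x|y] w IHw] /=.
  by have [<- _|] := eqVneq (inl x) l; first by exists [::], w.
have [<- _|_ /IHw[s [t [-> s0]]]] := eqVneq (inr y) l.
  by exists [::], w.
by exists (inr y :: s), t.
Qed.

Lemma yswap_front s t (y : Y) : word_deg s = 0%N ->
  yswap (s ++ inr y :: t) (inr y :: s ++ t).
Proof.
elim: s => [_|[//|z] s IHs] /=; first exact: YSwapRefl.
move=> /IHs{}IHs; apply: YSwapTrans (YSwapStep [::] _ _ _).
exact: (yswap_cat (YSwapRefl [:: inr z]) IHs).
Qed.

(** The first letter of [s] has positive count at index 0, so it occurs in [t] after letters from Y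
    only. If it is from X, the counts of [s] exclude any letter before it; if from Y, [yswap_front]
    moves it to the front. *)
Lemma word_cnt_inj s t : word_cnt s =2 word_cnt t -> yswap s t.
Proof.
elim: s t => [|l s IHs] t E.
  case: t E => [_|[x|y] t E]; first exact: YSwapRefl.
    by have := E 0%N (inl x); rewrite /= eqxx.
  by have := E 0%N (inr y); rewrite /= eqxx.
have [|t1 [t2 [tE t10]]] := @word_cnt0_split t l.
  by rewrite -E; case: l {E} => [x|y] /=; rewrite eqxx.
rewrite {}tE in E *; case: l E => [x|y] E.
  case: t1 t10 E => [|[//|y] t1] _ E; last first.
    by have := E 0%N (inr y); rewrite /= eqxx.
  apply: (yswap_cat (YSwapRefl [:: inl x])); apply: IHs => i l.
  exact: (E i.+1 l).
apply: YSwapTrans (YSwapSym (yswap_front _ _ t10)).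
apply: (yswap_cat (YSwapRefl [:: inr y])); apply: IHs => i l.
have := E i l; rewrite (yswap_word_cnt (yswap_front _ _ t10)) /=.
exact: addnI.
Qed.

Definition xdeg a := word_deg (repr a).

Definition xcnt a (p : nat * (X + Y)) := word_cnt (repr a) p.1 p.2.

Lemma repr_mmul a b : yswap (repr (mmul a b)) (repr a ++ repr b).
Proof. by apply/xywordP; rewrite xyword_repr. Qed.

Lemma repr_mone : repr (mone : xymon X Y) = [::].
Proof.
have /yswap_size : yswap (repr (mone : xymon X Y)) [::].
  by apply/xywordP; rewrite xyword_repr.
by case: (repr _).
Qed.

Lemma xdegM a b : xdeg (mmul a b) = (xdeg a + xdeg b)%N.
Proof.
by rewrite /xdeg (yswap_word_deg (repr_mmul a b)) /word_deg count_cat.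
Qed.

Lemma xcntM a b i l : xcnt (mmul a b) (i, l) =
  (xcnt a (i, l) + if xdeg a <= i then xcnt b (i - xdeg a, l) else 0)%N.
Proof. by rewrite /xcnt (yswap_word_cnt (repr_mmul a b)) word_cnt_cat. Qed.

Lemma xcnt_gt a i l : (xdeg a < i)%N -> xcnt a (i, l) = 0%N.
Proof. exact: word_cnt_gt. Qed.

Lemma xcnt_inj a b : xcnt a =1 xcnt b -> a = b.
Proof.
move=> E; rewrite -[a]xyword_repr -[b]xyword_repr; apply/xywordP.
by apply: word_cnt_inj => i l; apply: (E (i, l)).
Qed.

Lemma xcnt1 p : xcnt (mone : xymon X Y) p = 0%N.
Proof. by rewrite /xcnt repr_mone. Qed.

Lemma xdeg0_mmulC a b : xdeg a = 0%N -> xdeg b = 0%N -> mmul a b = mmul b a.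
Proof.
move=> a0 b0; apply: xcnt_inj => -[i l].
by rewrite !xcntM a0 b0 /= subn0 addnC.
Qed.

(** If [b] had a letter from X, the index 0 counts of [mmul b a] would be those of [b] alone,
    whereas those of [mmul a b] also include [a]. *)
Lemma xdeg0_comm a b : xdeg a = 0%N -> a <> mone -> mmul a b = mmul b a ->
  xdeg b = 0%N.
Proof.
move=> a0 a1 ab; apply: contrapT => /eqP; rewrite -lt0n => b0; apply: a1.
apply: xcnt_inj => -[[|i] l]; rewrite xcnt1; last by rewrite xcnt_gt ?a0.
have := xcntM a b 0 l; rewrite ab xcntM a0 /= leqNgt b0 /= subn0; lia.
Qed.

Lemma xdeg_comm_inj a b c : (0 < xdeg c)%N -> mmul a c = mmul c a ->
  mmul b c = mmul c b -> xdeg a = xdeg b -> a = b.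
Proof.
move=> c0 ac bc ab.
(* The exponent makes the degree of [cn] exceed [xdeg a]. *)
pose cn := iter (xdeg a).+1 (mmul c) mone.
have xdeg_iter n : xdeg (iter n (mmul c) mone) = (n * xdeg c)%N.
  by elim: n => [|n IHn]; rewrite /= ?xdegM ?IHn // /xdeg repr_mone.
have comm_iter d n : mmul d c = mmul c d ->
    mmul d (iter n (mmul c) mone) = mmul (iter n (mmul c) mone) d.
  move=> dc; elim: n => [|n IHn] /=; first by rewrite mul1m mulm1.
  by rewrite mulmA dc -!mulmA IHn.
(* At these indices [mmul cn d] sees only [cn], which determines the counts of [d]. The guard
   includes [i = xdeg a], where [cn] contributes its index 0 letters. *)
have cnt_le d i l : mmul d c = mmul c d -> xdeg d = xdeg a -> (i <= xdeg a)%N ->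
    (xcnt d (i, l) + (if xdeg a <= i then xcnt cn (i - xdeg a, l) else 0) =
     xcnt cn (i, l))%N.
  move=> dc da ia; rewrite -da -xcntM comm_iter // xcntM xdeg_iter.
  by rewrite leqNgt; case: ltnP => [_|]; [rewrite addn0 | nia].
apply: xcnt_inj => -[i l]; have [ia|ai] := leqP i (xdeg a); last first.
  by rewrite !xcnt_gt -?ab.
by have := cnt_le a i l ac erefl ia; have := cnt_le b i l bc (esym ab) ia; lia.
Qed.

(** Left multiplication shifts the deciding position by the degree of the factor; right
    multiplication keeps it, as the degrees of [a] and [b] agree in that case. *)
Lemma xymon_order : exists lt : xymon X Y -> xymon X Y -> Prop,
  [/\ [/\ forall a, ~ lt a a,
        forall a b c, lt a b -> lt b c -> lt a c &
        forall a b, a <> b -> lt a b \/ lt b a],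
      forall c a b, lt a b -> lt (mmul c a) (mmul c b),
      forall c a b, lt a b -> lt (mmul a c) (mmul b c),
      forall a b, lt a b -> (xdeg a <= xdeg b)%N &
      forall a, ~ lt a mone].
Proof.
have [ltL [ltL_trans ltL_total ltL_min]] := strict_well_order (X + Y)%type.
have gtrans := gridlt_trans ltL_trans; have gtotal := gridlt_total ltL_total.
have gmin := gridlt_min ltL_min.
pose lx := lexlt (gridlt ltL).
exists (fun a b => (xdeg a < xdeg b)%N \/
  xdeg a = xdeg b /\ lx (xcnt a) (xcnt b)).
split; first split.
- by move=> a [|[_]]; [rewrite ltnn | apply: lexlt_irr].
- move=> a b c [ab|[ab lab]] [bc|[bc lbc]];
    [left; lia|left; lia|left; lia|right].
  by split; [rewrite ab | apply: lexlt_trans lbc].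
- move=> a b nab; have [ab|ba|ab] := ltngtP (xdeg a) (xdeg b).
  + by left; left.
  + by right; left.
  + have [E|[h|h]] := lexlt_total gmin (xcnt a) (xcnt b).
    * by case: nab; apply: xcnt_inj.
    * by left; right.
    * by right; right.
- move=> c a b; rewrite !xdegM ltn_add2l => -[ab|[ab [[i l] [lti eqi]]]].
    by left.
  right; split; first by rewrite ab.
  exists (xdeg c + i, l)%N; split=> [|[j m] jm].
    by rewrite !xcntM leq_addr addKn ltn_add2l.
  rewrite !xcntM; case: leqP => // cj.
  by rewrite eqi //; apply: (@gridlt_add2l _ _ (xdeg c)); rewrite subnKC.
- move=> c a b; rewrite !xdegM ltn_add2r => -[ab|[ab [p [ltp eqp]]]].
    by left.
  right; split; first by rewrite ab.
  case: p => i l in ltp eqp *.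
  exists (i, l); split=> [|[j m] jm]; first by rewrite !xcntM ab ltn_add2r.
  by rewrite !xcntM ab eqp.
- by move=> a b [/ltnW|[-> _]].
- move=> a [|[_ [p []]]]; first by rewrite /xdeg repr_mone.
  by rewrite xcnt1.
Qed.

End WordInvariants.

(** * The centralizer theorem, by the degree of the leading monomial *)

Theorem theorem1 (k : fieldType) (X Y : choiceType) (u : {xyalg k[X, Y]})
    (hu : ~ exists c : k, u = c%:MP)
    (v w : {xyalg k[X, Y]}) (hv : v * u = u * v) (hw : w * u = u * w) :
  v * w = w * v.
Proof.
have [lt [[irr trans total] mul2l mul2r ltdeg lt1]] := xymon_order X Y.
have u0 : u != 0.
  by apply: contra_notN hu => /eqP->; exists 0; rewrite malgC0E.
have [m um] := lead_exists trans total u0; have [m0|m0] := posnP (xdeg m).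
  (* Nothing lies below [mone], so with that leading monomial [u] would be the scalar [u@_mone]. *)
  have m1 : m <> mone.
    move=> mE; apply: hu; exists u@_mone; apply/malgP => a.
    rewrite mcoeffC; have [->|/eqP a1] := eqVneq; first by rewrite mulr1n.
    rewrite mulr0n; apply/eqP; rewrite mcoeff_eq0; apply/negP => au.
    by have := um.2 a au; rewrite mE => /(_ a1)/lt1.
  have deg0 z : z * u = u * z -> forall a, a \in msupp z -> xdeg a = 0%N.
    have [->|/(lead_exists trans total)[b zb]] := eqVneq z 0.
      by rewrite msupp0.
    move=> zu a az; have bm := lead_comm irr trans mul2l mul2r zb um zu.
    have b0 := xdeg0_comm m0 m1 (esym bm).
    by have := lead_deg ltdeg zb az; rewrite b0 leqn0 => /eqP.
  apply: malg_mulC => a b av bw; apply: xdeg0_mmulC.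
    exact: deg0 av.
  exact: deg0 bw.
apply: (malg_centralizerC irr trans total mul2l mul2r (@xdegM X Y) ltdeg um m0)
  hv hw => a b.
exact: xdeg_comm_inj.
Qed.
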